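(* For every $\varepsilon>0$ and every $\xi>0$, there exists a finite union of two intervals $\mathcal{T}\subset\mathbb{R}$ such that $$1<|\xi|\operatorname{diam}_{\mathrm{ess}}(\mathcal{T})<1+\varepsilon$$ and $$|\widehat{\mathbf{1}_{\mathcal{T}}}(\xi)|>\widehat{\mathbf{1}_{I_T}}(\xi),$$ where $T=|\mathcal{T}|$ and $I_T=[-T/2,T/2]$.
   Context: The Fourier transform is $\widehat f(\xi)=\int_{\mathbb{R}}f(t)e^{-2\pi i\xi t}\,dt$, and $\mathbf{1}_{\mathcal{T}}$ is the indicator function of $\mathcal{T}$. $|\mathcal{T}|$ denotes Lebesgue measure. The essential diameter is $\operatorname{diam}_{\mathrm{ess}}(\mathcal{T})=\operatorname{ess\,sup}\mathcal{T}-\operatorname{ess\,inf}\mathcal{T}$, where $\operatorname{ess\,sup}\mathcal{T}$ and $\operatorname{ess\,inf}\mathcal{T}$ are the essential supremum and infimum of the identity function on $\mathcal{T}$. *)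

(* Defs.v *)
From HB Require Import structures.
From mathcomp Require Import all_boot all_order all_algebra.
From mathcomp Require Import all_classical all_reals all_analysis.
From mathcomp Require Import ess_sup_inf.
From mathcomp Require Export complex.
Set Implicit Arguments.
Unset Strict Implicit.
Unset Printing Implicit Defensive.

Import Order.TTheory GRing.Theory Num.Theory.
Import numFieldNormedType.Exports.
Local Open Scope classical_set_scope.
Local Open Scope ring_scope.
Local Open Scope complex_scope.

Section Definitions.
Context {R : realType}.
Implicit Types (T I J : set R) (f : R -> R[i]) (xi : R).

Definition expi (theta : R) : R[i] := cos theta +i* sin theta.

(* The integral of a complex-valued function, taken componentwise; as with
   [Rintegral], it is meaningful only when both components are integrable. *)
Definition Cintegral f : R[i] :=
  (\int[lebesgue_measure]_t complex.Re (f t))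
    +i* (\int[lebesgue_measure]_t complex.Im (f t)).

Definition fourier f xi : R[i] :=
  Cintegral (fun t => f t * expi (- (2 * pi * xi * t))).

Definition cindic T (t : R) : R[i] := (\1_T t : R)%:C.

Definition leb_length T : R := fine (lebesgue_measure T).

Definition centered_itv (L : R) : set R := `[- (L / 2), L / 2].

(* ess sup and ess inf of the identity on T are taken with respect to Lebesgue
   measure restricted to T; the result is extended-real, so a bound
   [diam_ess mT < r%:E] does say that T is essentially bounded. *)
Definition diam_ess T (mT : measurable T) : \bar R :=
  (ess_sup (mrestr lebesgue_measure mT) EFin
   - ess_inf (mrestr lebesgue_measure mT) EFin)%E.

(* The two intervals may be open, closed or half-open; they are nondegenerate,
   and separated by a gap, so that T is not, up to a null set, a single
   interval. *)
Definition union_of_two_intervals T : Prop :=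
  exists I J : set R,
    [/\ is_interval I /\ is_interval J,
        I° !=set0 /\ J° !=set0,
        closure I `&` closure J = set0
      & T = I `|` J].

End Definitions.

(* Main.v *)
Require Import Defs.
From HB Require Import structures.
From mathcomp Require Import all_boot all_order all_algebra.
From mathcomp Require Import all_classical all_reals all_analysis.
From mathcomp Require Import ess_sup_inf.
From mathcomp Require Import ring lra.
Set Implicit Arguments.
Unset Strict Implicit.
Unset Printing Implicit Defensive.

Import Order.TTheory GRing.Theory Num.Theory.
Import numFieldNormedType.Exports.
Local Open Scope classical_set_scope.
Local Open Scope ring_scope.

(** The exponential of frequency [xi] has period [xi^-1], so the transform of
    the centered interval of length exactly [xi^-1] vanishes at [xi]
    ([fourier_centered_itv_period]). It therefore suffices to find a set of
    that same length whose transform at [xi] is nonzero and whose diameter is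
    only slightly larger than its length. Cut the interval [`[0, xi^-1]] at its
    midpoint and move the right half to the right by [h = eta / xi]. The two
    halves cancelled each other before the move; afterwards the contribution
    of the moved half is rotated by the angle [2 * pi * eta], and the real part
    of the transform becomes [sin (2 * pi * eta) / (pi * xi)], which is
    positive as soon as [0 < eta < 1 / 2]. The diameter is
    [(1 + eta) / xi], so [0 < eta < eps] puts it in the required range.

    The real and imaginary parts of the transforms are integrals of [cos] and
    [sin] over intervals ([fourier_cindic]), computed with antiderivatives. *)

(** * Essential bounds and length of a union of two segments *)

Lemma ae_mrestr (R : realType) (T : set R) (mT : measurable T) (P : set R) :
  T `<=` P -> \forall x \ae mrestr lebesgue_measure mT, P x.
Proof.
move=> TP; exists (~` T); split; first exact: measurableC.
  by rewrite /mrestr setICl measure0.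
by move=> x /= nPx /TP.
Qed.

(** A segment inside [T] with distinct endpoints is not a null set of the
    restricted measure, so it cannot avoid a property that holds almost
    everywhere: short segments at the right and left ends of [T] thus bound
    [ess_sup] from below and [ess_inf] from above. *)
Lemma ae_mrestr_itv (R : realType) (T : set R) (mT : measurable T)
    (P : set R) (c b : R) : c < b -> `[c, b] `<=` T ->
  (\forall x \ae mrestr lebesgue_measure mT, P x) ->
  exists2 x, x \in `[c, b] & P x.
Proof.
move=> cb cbT [N [mN N0 PN]]; apply: contrapT => nP.
have : (lebesgue_measure `[c, b]%classic <= lebesgue_measure (N `&` T))%E.
  apply: le_measure; rewrite ?inE//; first exact: measurableI.
  by move=> x xcb; split; [apply: PN => Px; apply: nP; exists x | exact: cbT].
rewrite lebesgue_measure_itv/= lte_fin cb -EFinB.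
by rewrite [leRHS]N0 lee_fin leNgt subr_gt0 cb.
Qed.

Lemma ess_sup_mrestr_itv (R : realType) (T : set R) (mT : measurable T)
    (c b : R) : c < b -> `[c, b] `<=` T -> T `<=` `]-oo, b] ->
  ess_sup (mrestr lebesgue_measure mT) EFin = b%:E.
Proof.
move=> cb cbT Tb; apply/eqP; rewrite eq_le; apply/andP; split.
  by apply/ess_supP/ae_mrestr => x /Tb; rewrite /= in_itv.
apply/lee_subgt0Pr => e e0; set y := ess_sup _ _.
have c'b : Num.max c (b - e) < b by rewrite gt_max cb /= ltrBlDr ltrDl.
have c'T : `[Num.max c (b - e), b] `<=` T.
  by apply: subset_trans cbT; apply: subset_itvr; rewrite bnd_simp le_max lexx.
have yae : \forall x \ae mrestr lebesgue_measure mT, (x%:E <= y)%E.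
  exact: ess_sup_ge.
have [x] := ae_mrestr_itv c'b c'T yae.
rewrite in_itv/= ge_max => /andP[/andP[_ bex] _].
by apply: le_trans; rewrite -EFinB lee_fin.
Qed.

Lemma ess_inf_mrestr_itv (R : realType) (T : set R) (mT : measurable T)
    (a c : R) : a < c -> `[a, c] `<=` T -> T `<=` `[a, +oo[ ->
  ess_inf (mrestr lebesgue_measure mT) EFin = a%:E.
Proof.
move=> ac acT Ta; apply/eqP; rewrite eq_le; apply/andP; split; last first.
  by apply/ess_infP/ae_mrestr => x /Ta; rewrite /= in_itv/= andbT.
apply/lee_addgt0Pr => e e0; set y := ess_inf _ _.
have ac' : a < Num.min c (a + e) by rewrite lt_min ac /= ltrDl.
have c'T : `[a, Num.min c (a + e)] `<=` T.
  by apply: subset_trans acT; apply: subset_itvl; rewrite bnd_simp ge_min lexx.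
have yae : \forall x \ae mrestr lebesgue_measure mT, (y <= x%:E)%E.
  exact: ess_inf_le.
have [x] := ae_mrestr_itv ac' c'T yae.
rewrite in_itv/= le_min => /andP[_ /andP[_ xae]] yx.
by apply: le_trans yx _; rewrite -EFinD lee_fin.
Qed.

Lemma itvcc_disjoint (R : realType) (a b c d : R) : b < c ->
  `[a, b] `&` `[c, d] = set0 :> set R.
Proof.
move=> bc; apply/disj_set2P/disj_setPS => x [].
by rewrite /= !in_itv/=; lra.
Qed.

Lemma union_of_two_intervals_itvcc (R : realType) (a b c d : R) :
  a < b -> b < c -> c < d -> union_of_two_intervals (`[a, b] `|` `[c, d]).
Proof.
move=> ab bc cd; exists `[a, b]%classic, `[c, d]%classic; split => //.
- by split; exact: interval_is_interval.
- rewrite !interior_itv; split.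
    by exists ((a + b) / 2); rewrite /= in_itv/=; lra.
  by exists ((c + d) / 2); rewrite /= in_itv/=; lra.
- rewrite -!(closure_id _).1; [|exact: itv_closed|exact: itv_closed].
  exact: itvcc_disjoint.
Qed.

Lemma diam_ess_setU_itvcc (R : realType) (a b c d : R)
    (mT : measurable (`[a, b] `|` `[c, d] : set R)) :
  a < b -> b < c -> c < d -> diam_ess mT = (d - a)%:E.
Proof.
move=> ab bc cd; rewrite /diam_ess (ess_sup_mrestr_itv mT cd).
- rewrite (ess_inf_mrestr_itv mT ab); first by rewrite EFinB.
    exact: subsetUl.
  by move=> x [] /=; rewrite !in_itv/=; lra.
- exact: subsetUr.
- by move=> x [] /=; rewrite !in_itv/=; lra.
Qed.

Lemma leb_length_setU_itvcc (R : realType) (a b c d : R) :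
    a < b -> b < c -> c < d ->
  leb_length (`[a, b] `|` `[c, d]) = (b - a) + (d - c).
Proof.
move=> ab bc cd; pose I := `[a, b]%classic; pose J := `[c, d]%classic.
have -> : leb_length (I `|` J)
    = fine (lebesgue_measure I + lebesgue_measure J)%E.
  rewrite -measureU//; [exact: measurable_itv|exact: measurable_itv|].
  exact: itvcc_disjoint.
by rewrite !lebesgue_measure_itv/= !lte_fin ab cd -!EFinB -EFinD.
Qed.

(** * Integrals of sines and cosines over segments *)

Lemma Rintegral_antiderivative (R : realType) (f F : R -> R) (a b : R) :
    a < b -> continuous f -> (forall x : R, is_derive x 1 F (f x)) ->
  \int[lebesgue_measure]_(t in `[a, b]) f t = F b - F a.
Proof.
move=> ab cf dF.
have cF : continuous F.
  move=> x; apply/differentiable_continuous/derivable1_diffP.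
  exact: ex_derive.
rewrite /Rintegral (@continuous_FTC2 _ _ F)//.
- by apply: continuous_subspaceT.
- split; first by move=> x _; exact: ex_derive.
    by apply: cvg_at_right_filter; exact: cF.
  by apply: cvg_at_left_filter; exact: cF.
- by move=> x _; rewrite derive1E; exact: derive_val.
Qed.

Lemma continuous_cosM (R : realType) (v : R) :
  continuous (fun t : R => cos (v * t)).
Proof.
move=> t; apply: continuous_comp; last exact: continuous_cos.
by apply: continuousM => //; exact: cst_continuous.
Qed.

Lemma continuous_sinM (R : realType) (v : R) :
  continuous (fun t : R => sin (v * t)).
Proof.
move=> t; apply: continuous_comp; last exact: continuous_sin.
by apply: continuousM => //; exact: cst_continuous.
Qed.

Lemma Rintegral_cosM (R : realType) (v a b : R) : v != 0 -> a < b ->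
  \int[lebesgue_measure]_(t in `[a, b]) cos (v * t)
  = (sin (v * b) - sin (v * a)) / v.
Proof.
move=> v0 ab; rewrite mulrBl.
apply: (Rintegral_antiderivative (F := fun t => sin (v * t) / v)) => //.
- exact: continuous_cosM.
- by move=> t; apply: is_derive_eq; rewrite /GRing.scale /=; field.
Qed.

Lemma Rintegral_sinM (R : realType) (v a b : R) : v != 0 -> a < b ->
  \int[lebesgue_measure]_(t in `[a, b]) sin (v * t)
  = (cos (v * a) - cos (v * b)) / v.
Proof.
move=> v0 ab; rewrite mulrBl addrC -[X in _ + X]opprK.
apply: (Rintegral_antiderivative (F := fun t => - (cos (v * t) / v))) => //.
- exact: continuous_sinM.
- by move=> t; apply: is_derive_eq; rewrite /GRing.scale /=; field.
Qed.

Lemma Rintegral_cosM_setU_itvcc (R : realType) (v a b c d : R) :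
    v != 0 -> a < b -> b < c -> c < d ->
  \int[lebesgue_measure]_(t in `[a, b] `|` `[c, d]) cos (v * t)
  = (sin (v * b) - sin (v * a) + (sin (v * d) - sin (v * c))) / v.
Proof.
move=> v0 ab bc cd; rewrite Rintegral_setU//.
- by rewrite !Rintegral_cosM// -mulrDl.
- apply: continuous_compact_integrable.
    by apply: compactU; exact: segment_compact.
  by apply: continuous_subspaceT; exact: continuous_cosM.
- by apply/disj_set2P; exact: itvcc_disjoint.
Qed.

(** * Fourier transforms of indicators *)

Lemma fourier_cindic (R : realType) (A : set R) (xi : R) :
  fourier (cindic A) xi =
    Complex (\int[lebesgue_measure]_(t in A) cos (- (2 * pi * xi) * t))
            (\int[lebesgue_measure]_(t in A) sin (- (2 * pi * xi) * t)).
Proof.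
rewrite /fourier /Cintegral; congr Complex; rewrite [RHS]Rintegral_mkcond;
  apply: eq_Rintegral => t _; rewrite /= patchE indicE mulNr.
  by case: (t \in A) => /=; rewrite !(mul0r, mul1r, subr0).
by case: (t \in A) => /=; rewrite !(mul0r, mul1r, addr0).
Qed.

(** The interval carries exactly one period of the exponential, which
    integrates to zero. *)
Lemma fourier_centered_itv_period (R : realType) (xi : R) : 0 < xi ->
  fourier (cindic (centered_itv xi^-1)) xi = 0.
Proof.
move=> xi0; have pi0 := pi_gt0 R.
have v0 : - (2 * pi * xi) != 0 by rewrite oppr_eq0 !mulf_neq0// gt_eqF.
have L0 : 0 < xi^-1 by rewrite invr_gt0.
have L : - (xi^-1 / 2) < xi^-1 / 2 by lra.
rewrite fourier_cindic Rintegral_cosM// Rintegral_sinM//.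
have -> : - (2 * pi * xi) * (xi^-1 / 2) = - pi by field; rewrite gt_eqF.
have -> : - (2 * pi * xi) * - (xi^-1 / 2) = pi by field; rewrite gt_eqF.
by rewrite sinN cosN sinpi oppr0 addr0 subrr !mul0r.
Qed.

(** Pulling the two half-periods apart by the fraction [eta] of a period
    destroys their cancellation: the real part of the transform is
    [sin (2 * pi * eta) / (pi * xi)]. *)
Lemma fourier_split_period_neq0 (R : realType) (xi eta : R) :
    0 < xi -> 0 < eta -> eta < 1 / 2 ->
  let s := (2 * xi)^-1 in let h := eta / xi in
  fourier (cindic (`[0, s] `|` `[s + h, s + h + s])) xi != 0.
Proof.
move=> xi0 eta0 eta2; have pi0 := pi_gt0 R.
cbv zeta; set s := (2 * xi)^-1; set h := eta / xi.
have s0 : 0 < s by rewrite invr_gt0 mulr_gt0.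
have h0 : 0 < h by rewrite divr_gt0.
have v0 : - (2 * pi * xi) != 0 by rewrite oppr_eq0 !mulf_neq0// gt_eqF.
apply/eqP => /(congr1 (@complex.Re R)); rewrite fourier_cindic/=.
rewrite Rintegral_cosM_setU_itvcc// ?ltrDl ?ltrDr// mulr0 sin0.
have vs : - (2 * pi * xi) * s = - pi by rewrite /s; field; rewrite gt_eqF.
have vh : - (2 * pi * xi) * h = - (eta * 2 * pi).
  by rewrite /h; field; rewrite gt_eqF.
rewrite !(mulrDr (- (2 * pi * xi))) vs vh !(addrC (- pi)) -!opprD !sinN !sinDpi sinpi.
have theta : 0 < sin (eta * 2 * pi).
  by apply: sin_gt0_pi; rewrite !mulr_gt0//= gtr_pMl//; lra.
by move/eqP; rewrite mulf_eq0 invr_eq0 (negbTE v0) orbF; lra.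
Qed.

(** * Two separated half-periods against one full period *)

(* The last inequality is in R[i]: `z < w` means Im z = Im w and Re z < Re w. *)
Theorem corollary4p2 (R : realType) (eps : R) (heps : 0 < eps)
    (xi : R) (hxi : 0 < xi) :
  exists (T : set R) (mT : measurable T),
    [/\ union_of_two_intervals T,
        (1%:E < `|xi|%:E * diam_ess mT < (1 + eps)%:E)%E
      & fourier (cindic (centered_itv (leb_length T))) xi
          < `|fourier (cindic T) xi| ].
Proof.
(* Division by 4 secures both [eta < eps] and [eta < 1 / 2]. *)
pose eta := Num.min eps 1 / 4.
have eta0 : 0 < eta by rewrite divr_gt0// lt_min heps ltr01.
have etaeps : eta < eps.
  have : Num.min eps 1 <= eps by rewrite ge_min lexx.
  by rewrite /eta; lra.
have eta2 : eta < 1 / 2.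
  have : Num.min eps 1 <= 1 by rewrite ge_min lexx orbT.
  by rewrite /eta; lra.
pose s := (2 * xi)^-1; pose h := eta / xi.
have s0 : 0 < s by rewrite invr_gt0 mulr_gt0.
have h0 : 0 < h by rewrite divr_gt0.
have lt12 : s < s + h by lra.
have lt23 : s + h < s + h + s by lra.
have mT : measurable (`[0, s] `|` `[s + h, s + h + s] : set R).
  exact: measurableU.
exists (`[0, s] `|` `[s + h, s + h + s]), mT; split.
- exact: union_of_two_intervals_itvcc.
- rewrite diam_ess_setU_itvcc// subr0 -EFinM !lte_fin gtr0_norm//.
  have -> : xi * (s + h + s) = 1 + eta.
    by rewrite /s /h; field; rewrite gt_eqF.
  by lra.
- rewrite leb_length_setU_itvcc//.
  have -> : s - 0 + (s + h + s - (s + h)) = xi^-1.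
    by rewrite /s; field; rewrite gt_eqF.
  rewrite fourier_centered_itv_period// normr_gt0.
  exact: fourier_split_period_neq0.
Qed.
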